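(* For each context-free language $L$ there exist an integer $K$, a regular set $R$, and a homomorphism $h$ such that $L=h(D_K\cap R)$. Furthermore, if $G$ is a context-free grammar that generates $L$ and $G_k$ is the Dyck normal form of $G$ (a grammar in Dyck normal form, with $k$ bracket pairs, generating $L(G)$), then $K$, $R$, $h$ can be chosen so that: (i) if $G_k$ has no extended grammar, then $K=k$ and $D_K\cap R$ equals the trace-language $\mathcal{L}(G_k)$ of $G_k$; (ii) otherwise, there exists $p>0$ such that $K=k+p$ and $D_K\cap R=D'_K$, where $D'_K=\mathcal{L}(G_k)\cup L_p$ is the subset of $D_K$ defined in the context.
   Context: A context-free grammar $G=(N,T,P,S)$ consists of disjoint finite sets $N$ (nonterminals) and $T$ (terminals), an axiom $S\in N$, and a finite set of productions $P\subseteq N\times(N\cup T)^*$; $L(G)\subseteq T^*$ is the generated language, and $\lambda$ denotes the empty string. $G$ is in Chomsky normal form if every rule has the form $A\to BC$ or $A\to a$ with $A,B,C\in N$, $a\in T$, where in addition the rule $S\to\lambda$ is allowed provided $S$ does not occur on the right-hand side of any rule. $G$ is in Dyck normal form if: (1) $G$ is in Chomsky normal form; (2) if $A\to a\in P$ with $A\in N$, $A\ne S$, $a\in T$, then no other rule in $P$ rewrites $A$; (3) for each $A\in N$ such that $X\to AB\in P$ (respectively $X\to BA\in P$) there is no rule in $P$ of the form $X'\to B'A$ (respectively $X'\to AB'$); that is, no nonterminal occurs both as the left and as the right symbol of right-hand sides of length two; (4) for any rules $X\to AB$ and $X'\to A'B$ in $P$ one has $A=A'$, and for any rules $X\to AB$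 and $X'\to AB'$ in $P$ one has $B=B'$. Bracket notation: by (3) and (4) the nonterminals occurring on right-hand sides are grouped into pairs $(A,B)$ (those with some rule $X\to AB$); each such pair is named $([_i,]_i)$, and a grammar in Dyck normal form with $k$ pairs is written $G_k=(N_k,T,P_k,S)$ with $N_k=\{S,[_1,\dots,[_k,]_1,\dots,]_k\}$ and rules of the form $X\to[_i\,]_i$ or $Y\to t$, $X,Y\in N_k$, $t\in T$ (or possibly $S\to\lambda$). Trace-language: let $D: S\Rightarrow u_1\Rightarrow\dots\Rightarrow u_{2n-1}=w$, $n\ge2$, be a leftmost derivation of $w\in L(G_k)$ (so $|w|=n$). The trace-word $t_{w,D}$ is the concatenation of the nonterminals consecutively rewritten in $D$, excluding the axiom $S$ rewritten in the first step. The trace-language $\mathcal{L}(G_k)$ is the set of all $t_{w,D}$, for all $w\in L(G_k)$ with $|w|\ge2$ and all leftmost derivations $D$ of $w$. The one-sided Dyck language $D_K$ over $K$ letters is the language generated, over an alphabet of $K$ bracket pairs, by the context-free grammar with single nonterminal $S$ and rules $S\to[_i\,S\,]_i$, $S\to SS$, $S\to[_i\,]_i$ for each of the $K$ pairs (so $\lambda\notin D_K$, and $D_0=\emptyset$). The homomorphism $h$ maps words over the alphabet of $K$ bracket pairs to words over the terminal alphabet of $L$. Extended grammar: $G_k$ has an extended grammar if and only if it has at least one rule $S\to t$ with $t\in T\cup\{\lambda\}$. In that case let $t_{k+1},\dots,t_{k+p}$, $p>0$, be the distinct elements $t\in T\cup\{\lambda\}$ with $S\to t\in P_k$, introduce $p$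 new bracket pairs $[_{t_{k+i}},]_{t_{k+i}}$, $1\le i\le p$, let $D_K$ with $K=k+p$ be the Dyck language over the $k$ pairs of $G_k$ together with these $p$ new pairs, and put $L_p=\{[_{t_{k+1}}\,]_{t_{k+1}},\dots,[_{t_{k+p}}\,]_{t_{k+p}}\}$ and $D'_K=\mathcal{L}(G_k)\cup L_p$. *)

(* Defs.v *)
From mathcomp Require Import all_boot.
From mathcomp Require Import classical_sets.

Set Implicit Arguments.
Unset Strict Implicit.
Unset Printing Implicit Defensive.

Local Open Scope classical_set_scope.

(* The sum type [nonterm + T] of symbols makes N and T disjoint. *)
Record cfg (T : finType) := CFG {
  nonterm : finType;
  start : nonterm;
  prods : seq (nonterm * seq (nonterm + T))
}.

Section Grammar.
Variables (T : finType) (G : cfg T).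

Definition symbol : Type := (nonterm G + T)%type.

Definition is_terminal (s : symbol) : bool := if s is inr _ then true else false.

Definition rewrites_at (i : nat) (u v : seq symbol) : bool :=
  has (fun p => (onth u i == Some (inl p.1)) &&
                (v == take i u ++ p.2 ++ drop i.+1 u)) (prods G).

Definition step (u v : seq symbol) : bool :=
  [exists i : 'I_(size u), rewrites_at i u v].

Definition leftmost_step (u v : seq symbol) : bool :=
  [exists i : 'I_(size u), all is_terminal (take i u) && rewrites_at i u v].

(* [D] lists the sentential forms u_1, u_2, ... after the initial form S. *)
Definition derivation (D : seq (seq symbol)) (w : seq T) : Prop :=
  path step [:: inl (start G)] D /\ last [:: inl (start G)] D = map inr w.

Definition leftmost_derivation (D : seq (seq symbol)) (w : seq T) : Prop :=
  path leftmost_step [:: inl (start G)] D /\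
  last [:: inl (start G)] D = map inr w.

Definition cfg_lang : set (seq T) := [set w | exists D, derivation D w].

Definition leftmost_nonterm (u : seq symbol) : option (nonterm G) :=
  ohead (pmap (fun s : symbol => if s is inl A then Some A else None) u).

(* In a leftmost derivation the nonterminal rewritten in u_j is the leftmost
   one. As [D] omits the initial form, the first rewriting of S is left out,
   and the final terminal word contributes nothing. *)
Definition trace_word (D : seq (seq symbol)) : seq (nonterm G) :=
  pmap leftmost_nonterm D.

Definition trace_lang : set (seq (nonterm G)) :=
  [set t | exists (w : seq T) (D : seq (seq symbol)),
     [/\ 2 <= size w, leftmost_derivation D w & t = trace_word D]].

Definition chomsky_nf : Prop :=
  (forall A r, (A, r) \in prods G ->
     [\/ exists B C, r = [:: inl B; inl C],
         exists a, r = [:: inr a] |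
         A = start G /\ r = [::]]) /\
  ((start G, [::]) \in prods G ->
     forall A r, (A, r) \in prods G -> inl (start G) \notin r).

Definition dyck_nf : Prop :=
  [/\ chomsky_nf,
      forall A a, A <> start G -> (A, [:: inr a]) \in prods G ->
        forall r, (A, r) \in prods G -> r = [:: inr a],
      forall X X' A B B', (X, [:: inl A; inl B]) \in prods G ->
        (X', [:: inl B'; inl A]) \notin prods G &
      (forall X X' A A' B, (X, [:: inl A; inl B]) \in prods G ->
        (X', [:: inl A'; inl B]) \in prods G -> A = A') /\
      (forall X X' A B B', (X, [:: inl A; inl B]) \in prods G ->
        (X', [:: inl A; inl B']) \in prods G -> B = B')].

(* [None] stands for the empty word, so [t] ranges over T extended by lambda. *)
Definition start_rule (t : option T) : bool :=
  (start G, if t is Some a then [:: inr a] else [::]) \in prods G.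

Definition has_extended : Prop := exists t, start_rule t.

End Grammar.

Definition context_free (T : finType) (L : set (seq T)) : Prop :=
  exists G : cfg T, L = cfg_lang G.

Definition bracket (K : nat) : finType := ('I_K * bool)%type.
Definition opening (K : nat) (i : 'I_K) : bracket K := (i, true).
Definition closing (K : nat) (i : 'I_K) : bracket K := (i, false).

Definition dyck_grammar (K : nat) : cfg (bracket K) :=
  @CFG (bracket K) unit tt
    ((tt, [:: inl tt; inl tt]) ::
     [seq (tt, [:: inr (opening i); inl tt; inr (closing i)]) | i <- enum 'I_K] ++
     [seq (tt, [:: inr (opening i); inr (closing i)]) | i <- enum 'I_K]).

Definition dyck (K : nat) : set (seq (bracket K)) := cfg_lang (dyck_grammar K).

(* [br] identifies the nonterminals other than the axiom with the [2 * k]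
   brackets: N_k = {S, [_1, ..., [_k, ]_1, ..., ]_k}, all distinct (so S is not
   a bracket), the pairs being exactly the right-hand sides of length two. *)
Definition bracket_naming (T : finType) (G : cfg T) (k : nat)
    (br : bracket k -> nonterm G) : Prop :=
  [/\ injective br,
      forall x, br x <> start G,
      forall A, A = start G \/ exists x, A = br x &
      forall A B, (exists X, (X, [:: inl A; inl B]) \in prods G) <->
                  (exists i, A = br (opening i) /\ B = br (closing i))].

Definition bracket_trace_lang (T : finType) (G : cfg T) (k : nat)
    (br : bracket k -> nonterm G) : set (seq (bracket k)) :=
  [set x | trace_lang (map br x)].

Definition enumerates_start_rules (T : finType) (G : cfg T) (p : nat)
    (ts : p.-tuple (option T)) : Prop :=
  uniq ts /\ forall t, (t \in ts) = start_rule G t.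

(* D'_K for K = k + p: the k pairs of G come first, and the pair [k + j] is the
   one attached to the j-th element of an enumeration of the t with S -> t. *)
Definition extended_trace_lang (T : finType) (G : cfg T) (k : nat)
    (br : bracket k -> nonterm G) (p : nat) : set (seq (bracket (k + p))) :=
  [set map (fun b : bracket k => (lshift p b.1, b.2) : bracket (k + p)) x
     | x in bracket_trace_lang br] `|`
  [set w | exists j : 'I_p, w = [:: opening (rshift k j); closing (rshift k j)]].

Record dfa (A : finType) := DFA {
  dfa_state : finType;
  dfa_start : dfa_state;
  dfa_final : pred dfa_state;
  dfa_trans : dfa_state -> A -> dfa_state
}.

Definition dfa_lang (A : finType) (M : dfa A) : set (seq A) :=
  [set w | dfa_final (foldl (@dfa_trans A M) (dfa_start M) w)].

Definition regular (A : finType) (R : set (seq A)) : Prop :=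
  exists M : dfa A, R = dfa_lang M.

Definition word_hom (A B : Type) (h : seq A -> seq B) : Prop :=
  h [::] = [::] /\ {morph h : u v / u ++ v}.

(* Main.v *)
(** The trace-word of a leftmost derivation lists the nonterminals of the parse
    tree in preorder. After a binary rule the trace continues with the opening
    bracket, the trace below it, then the closing bracket and the trace below
    that, so traces are well-parenthesised. Conversely a well-parenthesised word is a trace as soon
    as each letter is compatible with the next one: a letter rewritten by a
    binary rule is followed by the opening bracket of such a rule, and a letter
    rewritten by a terminal rule by some closing bracket or the end of the word,
    the Dyck condition forcing the closing bracket to be the right one. This
    local condition is regular. Since a bracket with a terminal rule has no
    other rule, mapping it to its terminal, and all other brackets to the empty
    word, recovers the generated word.

    For an arbitrary grammar the same local conditions, applied to brackets
    indexed by the positions in the right-hand sides, give the first part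
    without going through a normal form. *)

Require Import Defs.
From mathcomp Require Import all_boot.
From mathcomp Require Import classical_sets.

Set Implicit Arguments.
Unset Strict Implicit.
Unset Printing Implicit Defensive.

Local Open Scope classical_set_scope.

(** * Parse forests, derivations and leftmost traces *)

Section Parses.
Variables (T : finType) (G : cfg T).

(* [parses s w t]: a forest with roots [s] and frontier [w], whose nonterminals
   in preorder are [t]. *)
Inductive parses : seq (symbol G) -> seq T -> seq (nonterm G) -> Prop :=
| parses_nil : parses [::] [::] [::]
| parses_term a s w t : parses s w t -> parses (inr a :: s) (a :: w) t
| parses_rule A r s u v t1 t2 : (A, r) \in prods G ->
    parses r u t1 -> parses s v t2 ->
    parses (inl A :: s) (u ++ v) (A :: t1 ++ t2).

Lemma parses_inv s w t : parses s w t ->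
  match s with
  | [::] => w = [::] /\ t = [::]
  | inr a :: s' => exists w', w = a :: w' /\ parses s' w' t
  | inl A :: s' => exists r u v t1 t2,
      [/\ (A, r) \in prods G, parses r u t1, parses s' v t2, w = u ++ v
        & t = A :: t1 ++ t2]
  end.
Proof.
case=> [//|a s' w' t' p|A r s' u v t1 t2 rP p1 p2]; first by exists w'.
by exists r, u, v, t1, t2.
Qed.

Lemma parses1 A r w t : (A, r) \in prods G -> parses r w t ->
  parses [:: inl A] w (A :: t).
Proof.
move=> rP p; rewrite -[w]cats0 -[t]cats0.
exact: parses_rule rP p parses_nil.
Qed.

Lemma parses1_inv A w t : parses [:: inl A] w t ->
  exists r t', [/\ (A, r) \in prods G, parses r w t' & t = A :: t'].
Proof.
case/parses_inv => r [u] [v] [t1] [t2] [rP p /parses_inv[-> ->] -> ->].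
by exists r, t1; rewrite !cats0.
Qed.

Lemma parses_terms w : parses (map inr w) w [::].
Proof. by elim: w => [|a w IH]; [exact: parses_nil | exact: parses_term]. Qed.

Lemma parses_cat s1 w1 t1 s2 w2 t2 : parses s1 w1 t1 -> parses s2 w2 t2 ->
  parses (s1 ++ s2) (w1 ++ w2) (t1 ++ t2).
Proof.
move=> p1 p2; elim: p1 => [//|a s w t _ IH|A r s u v t t' rP pr _ _ IH] /=.
  exact: parses_term.
by rewrite -!catA; exact: parses_rule rP pr IH.
Qed.

Lemma parses_split s1 s2 w t : parses (s1 ++ s2) w t ->
  exists w1 w2 t1 t2, [/\ parses s1 w1 t1, parses s2 w2 t2,
    w = w1 ++ w2 & t = t1 ++ t2].
Proof.
elim: s1 w t => [|[A|a] s1 IH] w t /=.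
- by move=> p; exists [::], w, [::], t; split=> //; exact: parses_nil.
- case/parses_inv => r [u] [v] [t1] [t2] [rP pr /IH p -> ->].
  case: p => w1 [w2] [t3] [t4] [p1 p2 -> ->].
  exists (u ++ w1), w2, (A :: t1 ++ t3), t4; rewrite /= !catA; split=> //.
  exact: parses_rule rP pr p1.
- case/parses_inv => w' [-> /IH] [w1] [w2] [t1] [t2] [p1 p2 -> ->].
  by exists (a :: w1), w2, t1, t2; split=> //; exact: parses_term.
Qed.

Lemma rewrites_atP i (u v : seq (symbol G)) : rewrites_at i u v ->
  exists A r, [/\ (A, r) \in prods G, u = take i u ++ inl A :: drop i.+1 u
    & v = take i u ++ r ++ drop i.+1 u].
Proof.
case/hasP => -[A r] rP /= /andP[/eqP uA /eqP ->]; exists A, r; split=> //.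
have ltiu : i < size u by rewrite -onthTE uA.
by rewrite -(onth_nth (inl (start G)) _ _ _ uA) -drop_nth ?cat_take_drop.
Qed.

(** Undoing a rewriting gathers the trees grown from the right-hand side under one new root. The
    preorder word is left open, as the rewritten occurrence may be anywhere. *)
Lemma step_parses u v w t : step u v -> parses v w t ->
  exists t', parses u w t'.
Proof.
case/existsP => i /rewrites_atP[A [r [rP]]].
move: (take i u) (drop i.+1 u) => l l' -> -> /parses_split.
case=> [w1] [w2] [t1] [t2] [p1 + -> _].
case/parses_split => w3 [w4] [t3] [t4] [p3 p4 -> _].
exists (t1 ++ A :: t3 ++ t4); apply: parses_cat p1 _.
exact: parses_rule rP p3 p4.
Qed.

Lemma all_terminal s : all (@is_terminal T G) s -> exists p, s = map inr p.
Proof.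
elim: s => [|[//|a] s IH] /=; first by exists [::].
by move/IH => [p ->]; exists (a :: p).
Qed.

Lemma leftmost_nonterm_terms p s :
  leftmost_nonterm (map inr p ++ s) = @leftmost_nonterm T G s.
Proof. by elim: p. Qed.

(** Only terminals precede the rewritten occurrence, so the new root comes first in preorder. *)
Lemma leftmost_step_parses u v w t : leftmost_step u v -> parses v w t ->
  exists2 A, leftmost_nonterm u = Some A & parses u w (A :: t).
Proof.
case/existsP => i /andP[/all_terminal[p ti]] /rewrites_atP[A [r [rP]]].
move: (drop i.+1 u) => l; rewrite ti => -> -> pv.
exists A; first by rewrite leftmost_nonterm_terms.
elim: p w pv {ti} => [|a p IH] w /=; last first.
  by case/parses_inv => w' [-> /IH]; exact: parses_term.
case/parses_split => w3 [w4] [t3] [t4] [p3 p4 -> ->].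
exact: parses_rule rP p3 p4.
Qed.

(** Unlike in [trace_word], the initial form [s] contributes too, so that the trace matches the
    whole preorder word. *)
Definition leftmost_trace s w t : Prop := exists D,
  [/\ path (@leftmost_step T G) s D, last s D = map inr w
    & t = pmap (@leftmost_nonterm T G) (s :: D)].

Lemma leftmost_trace_parses s w t : leftmost_trace s w t -> parses s w t.
Proof.
case=> D [+ + ->]; elim: D s => [|s' D IH] s.
  move=> _ /= ->; rewrite -[X in leftmost_nonterm X]cats0.
  rewrite leftmost_nonterm_terms /=; exact: parses_terms.
rewrite [path _ _ _]/= [last _ _]/= => /andP[ss' pD] /(IH _ pD) p.
by have [A /= ->] := leftmost_step_parses ss' p.
Qed.

Lemma rewrites_at_rule p A r s : (A, r) \in prods G ->
  rewrites_at (size p) (p ++ inl A :: s) (p ++ r ++ s).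
Proof.
move=> rP; apply/hasP; exists (A, r) => //=.
rewrite take_size_cat // -cat_rcons drop_size_cat ?size_rcons // eqxx andbT.
by rewrite cat_rcons onth_cat ltnn subnn /=.
Qed.

Lemma leftmost_step_rule p A r s : (A, r) \in prods G ->
  leftmost_step (map inr p ++ inl A :: s) (map inr p ++ r ++ s).
Proof.
move=> rP; apply/existsP.
have lt : size (map inr p : seq (symbol G)) <
    size (map inr p ++ inl A :: s : seq (symbol G)).
  by rewrite size_cat /= addnS ltnS leq_addr.
exists (Ordinal lt) => /=.
by rewrite rewrites_at_rule // take_size_cat // all_map andbT; elim: p {lt}.
Qed.

Lemma leftmost_step_trace p A r s w t : (A, r) \in prods G ->
  leftmost_trace (map inr p ++ r ++ s) w t ->
  leftmost_trace (map inr p ++ inl A :: s) w (A :: t).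
Proof.
move=> rP [D [pD lD ->]]; exists ((map inr p ++ r ++ s) :: D).
split=> //; first by apply/andP; split => //; exact: leftmost_step_rule.
by rewrite [pmap _ (_ :: _ :: _)]/(oapp _ _ _) leftmost_nonterm_terms.
Qed.

(** A leftmost derivation finishes one tree before it enters the next. The terminal prefix [p] and
    the waiting roots [s'] vary in the induction, and the rest of the derivation is given from the
    form reached once [s] has become [w]. *)
Lemma parses_leftmost_cat s w t : parses s w t -> forall p s' w' t',
  leftmost_trace (map inr (p ++ w) ++ s') w' t' ->
  leftmost_trace (map inr p ++ s ++ s') w' (t ++ t').
Proof.
elim=> [p s' w' t'|a {}s {}w {}t _ IH p s' w' t'
       |A r {}s u v t1 t2 rP _ IH1 _ IH2 p s' w' t'] /=.
- by rewrite cats0.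
- by rewrite -!cat_rcons -map_rcons; exact: IH.
- rewrite catA -(catA t1) => lt; apply: leftmost_step_trace rP _.
  by apply: IH1; apply: IH2.
Qed.

Lemma parses_leftmost_trace s w t : parses s w t <-> leftmost_trace s w t.
Proof.
split; last exact: leftmost_trace_parses.
move=> p; rewrite -[s]cats0 -[t]cats0.
apply: (parses_leftmost_cat p (p := [::])); exists [::]; rewrite cats0.
split=> //=; rewrite -[X in leftmost_nonterm X]cats0.
by rewrite leftmost_nonterm_terms.
Qed.

Lemma leftmost_step_step u v : @leftmost_step T G u v -> step u v.
Proof. by case/existsP => i /andP[_ uv]; apply/existsP; exists i. Qed.

Lemma cfg_langP w : cfg_lang G w <-> exists t, parses [:: inl (start G)] w t.
Proof.
split=> [[D []]|[t /parses_leftmost_trace[D [pD lD _]]]].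
  elim: D [:: _] => [|s' D IH] s /=.
    by move=> _ ->; exists [::]; exact: parses_terms.
  by case/andP => ss' pD /(IH _ pD)[t]; exact: step_parses.
by exists D; split=> //; apply: sub_path pD => u v; exact: leftmost_step_step.
Qed.

Lemma trace_langP (t : seq (nonterm G)) : trace_lang t <->
  exists2 w, 2 <= size w & parses [:: inl (start G)] w (start G :: t).
Proof.
split=> [[w [D [w2 [pD lD] ->]]]|[w w2 /parses_leftmost_trace[D [pD lD [tD]]]]].
  by exists w => //; apply/parses_leftmost_trace; exists D.
by exists w, D.
Qed.

End Parses.

(** * Balanced words under local conditions *)

Section Nested.
(** [foll o j]: the opening bracket [j] may come right after [o]. [fin b]: a closing bracket or the
    end of the word may come right after [b]. *)
Variables (K : nat) (foll : option (bracket K) -> 'I_K -> bool).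
Variable fin : bracket K -> bool.

Let ends o := if o is Some b then fin b else false.

(* [nested o x]: [x] may be enclosed between the letter [o] ([None] at the
   beginning of the word) and a closing bracket or the end of the word. *)
Inductive nested : option (bracket K) -> seq (bracket K) -> Prop :=
| nested_nil b : fin b -> nested (Some b) [::]
| nested_cons o j u v : foll o j -> nested (Some (opening j)) u ->
    nested (Some (closing j)) v ->
    nested o (opening j :: u ++ closing j :: v).

Inductive balanced : seq (bracket K) -> Prop :=
| balanced_nil : balanced [::]
| balanced_cons j u v : balanced u -> balanced v ->
    balanced (opening j :: u ++ closing j :: v).

Lemma balanced_cat x y : balanced x -> balanced y -> balanced (x ++ y).
Proof.
move=> bx By; elim: bx => //= j u v bu _ _ bv.
by rewrite -catA; exact: balanced_cons.
Qed.

Lemma dyck_balanced (x : seq (bracket K)) : dyck x <-> balanced x /\ x <> [::].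
Proof.
pose D := dyck_grammar K.
have rP (r : seq (symbol D)) : (tt, r) \in prods D <->
    [\/ r = [:: inl tt; inl tt],
      exists j, r = [:: inr (opening j); inl tt; inr (closing j)]
    | exists j, r = [:: inr (opening j); inr (closing j)]].
  rewrite inE mem_cat; split.
    case/orP => [/eqP[->]|]; first by constructor.
    case/orP => /mapP[j _ [->]]; first by constructor 2; exists j.
    by constructor 3; exists j.
  case=> [->|[j ->]|[j ->]]; first by rewrite eqxx.
    by rewrite (map_f (fun i => (tt, _))) ?mem_enum // orbT.
  apply/orP; right; apply/orP; right.
  by rewrite (map_f (fun i => (tt, _))) ?mem_enum.
rewrite /dyck cfg_langP; split=> [[t]|[]].
  (* Structural induction would leave the single root tree by tree; the preorder word shrinks at
     each rule. *)
  have [n] := ubnP (size t); elim: n x t => // n IH x t ltn p.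
  have [r [t' [/rP ruleP p' et]]] := parses1_inv p; subst t.
  case: ruleP p' => [->|[j ->]|[j ->]].
  - rewrite -[[:: _; _]]/([:: inl tt] ++ [:: inl tt]).
    case/parses_split => w1 [w2] [t1] [t2] [p1 p2 -> et].
    move: ltn; rewrite et /= ltnS size_cat => ltn.
    have [b1 n1] := IH _ _ (leq_ltn_trans (leq_addr _ _) ltn) p1.
    have [b2 n2] := IH _ _ (leq_ltn_trans (leq_addl _ _) ltn) p2.
    by split; [exact: balanced_cat | case: (w1) n1].
  - case/parses_inv => w' [->].
    rewrite -[[:: _; _]]/([:: inl tt] ++ [:: inr (closing j)]).
    case/parses_split => w1 [w2] [t1] [t2] [p1 + -> et].
    case/parses_inv => w3 [-> /parses_inv[-> _]].
    move: ltn; rewrite et /= ltnS size_cat => ltn.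
    have [b1 n1] := IH _ _ (leq_ltn_trans (leq_addr _ _) ltn) p1.
    by split=> //; apply: balanced_cons => //; exact: balanced_nil.
  - case/parses_inv => w' [-> /parses_inv[w3 [-> /parses_inv[-> _]]]].
    by split=> //; apply: (@balanced_cons j [::] [::]); exact: balanced_nil.
elim=> // j u v bu IHu bv IHv _.
(* The Dyck grammar does not generate the empty word, so empty [u] and empty [v] need separate
   rules. *)
have [t pt] : exists t,
    parses (G := D) [:: inl tt] (opening j :: u ++ [:: closing j]) t.
  case: u {bu} IHu => [_|a u /(_ _)[//|t pt]].
    eexists;
      apply: (@parses1 _ D tt [:: inr (opening j); inr (closing j)]).
      by apply/rP; constructor 3; exists j.
    exact: (parses_terms _ [:: opening j; closing j]).
  eexists;
    apply: (@parses1 _ D tt [:: inr (opening j); inl tt; inr (closing j)]).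
    by apply/rP; constructor 2; exists j.
  apply: parses_term; apply: (parses_cat pt).
  exact: (parses_terms _ [:: closing j]).
case: v {bv} IHv => [_|a v /(_ _)[//|t' pt']]; first by exists t.
eexists; apply: (@parses1 _ D tt [:: inl tt; inl tt]).
  by apply/rP; constructor.
rewrite -cat_rcons -cat_cons -cats1; exact: parses_cat pt pt'.
Qed.

(* A closing bracket may follow [o] exactly when the word may end at [o]. *)
Fixpoint chained (o : option (bracket K)) (x : seq (bracket K)) : bool :=
  match x with
  | [::] => ends o
  | b :: x' => (if b.2 then foll o b.1 else ends o) && chained (Some b) x'
  end.

(* The state is the last letter read, [None] being the sink. *)
Definition chain_dfa : dfa (bracket K) :=
  @DFA (bracket K) (option (option (bracket K))) (Some None)
    (fun q => if q is Some o then ends o else false)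
    (fun q b => if q is Some o then
       if (if b.2 then foll o b.1 else ends o) then Some (Some b) else None
     else None).

Lemma chain_dfa_lang x : dfa_lang chain_dfa x <-> chained None x.
Proof.
rewrite /dfa_lang /mkset [dfa_start _]/=.
have sink y : foldl (@dfa_trans _ chain_dfa) None y = None by elim: y.
elim: x None => // b x IH o /=.
by case: ifP => _ /=; [exact: IH | rewrite sink].
Qed.

(** The rest [y] is empty or starts with a closing bracket, which [chained] accepts because [fin]
    holds where [x] ends. *)
Lemma nested_chained o x y : nested o x ->
  (if y is b :: y' then ~~ b.2 && chained (Some b) y' else true) ->
  chained o (x ++ y).
Proof.
move=> nx; elim: nx y => [b fb y|{}o j u v oj _ IHu _ IHv y Hy].
  by case: y => [|[j []] y] //=; rewrite fb.
by rewrite /= oj -catA; apply: IHu; exact: IHv.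
Qed.

(** Balance supplies the matching brackets and [chained] the conditions between neighbours. The
    chain on the rest [y] is handed back for the next part of the word. *)
Lemma balanced_chained o x y : balanced x ->
  (if y is b :: _ then ~~ b.2 else true) -> chained o (x ++ y) ->
  nested o x /\ (if y is b :: y' then chained (Some b) y' else true).
Proof.
move=> bx; elim: bx o y => [|j u v _ IHu _ IHv] o y.
  have nil : ends o -> nested o [::] by case: o => // b; exact: nested_nil.
  by case: y => [|[j []] y] //= _; [|case/andP] => /nil.
rewrite /= -catA => Hy /andP[oj] /IHu[//|nu /IHv[//|nv cy]].
by split=> //; exact: nested_cons.
Qed.

Lemma nested_balanced o x : nested o x -> balanced x.
Proof.
elim=> [b _|{}o j u v _ _ bu _ bv]; [exact: balanced_nil|exact: balanced_cons].
Qed.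

Lemma dyck_chained : @dyck K `&` dfa_lang chain_dfa = nested None.
Proof.
apply/seteqP; split=> x.
  case=> /dyck_balanced[bx _] /chain_dfa_lang; rewrite -[x in chained _ x]cats0.
  by case/(balanced_chained bx).
move=> nx; have cx : chained None x.
  by rewrite -[x]cats0; apply: nested_chained nx _.
split; last exact/chain_dfa_lang.
apply/dyck_balanced; split; first exact: nested_balanced nx.
(* [chained None] rejects the empty word, since [ends None] is false. *)
by move=> x0; rewrite x0 in cx.
Qed.

End Nested.

(** * Homomorphisms defined letter by letter *)

Definition letters (A B : Type) (h : A -> seq B) x := flatten (map h x).

Lemma letters_hom (A B : Type) (h : A -> seq B) : word_hom (letters h).
Proof. by split=> // u v; rewrite /letters map_cat flatten_cat. Qed.

Lemma letters_cons (A B : Type) (h : A -> seq B) a x :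
  letters h (a :: x) = h a ++ letters h x.
Proof. by []. Qed.

Lemma letters_cat (A B : Type) (h : A -> seq B) x y :
  letters h (x ++ y) = letters h x ++ letters h y.
Proof. exact: (letters_hom h).2. Qed.

(** * Coding the parses of an arbitrary grammar *)

Section Suffixes.
Variables (T : finType) (G : cfg T).

(* Bracket pairs are indexed by the nonempty suffixes of right-hand sides: the
   bracket pair of [X :: s] encloses the code of the parse of [X], and the code
   of the parse of [s] follows it. *)
Definition suffixes : seq (seq (symbol G)) :=
  [:: inl (start G)] ::
    flatten [seq [seq drop i p.2 | i <- iota 0 (size p.2)] | p <- prods G].

Local Notation K := (size suffixes).

Definition suffix (j : 'I_K) : seq (symbol G) := nth [::] suffixes j.

(** The possible roots [r] of the forest coded right after [o]. Inside the pair of [X :: s] these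
    are the children of [X], none if [X] is a terminal; after the pair they are [s]. *)
Definition continuation (o : option (bracket K)) (r : seq (symbol G)) : bool :=
  match o with
  | None => r == [:: inl (start G)]
  | Some (j, true) => match suffix j with
                      | inl A :: _ => (A, r) \in prods G
                      | _ => r == [::]
                      end
  | Some (j, false) => r == behead (suffix j)
  end.

Definition continues_at o j := continuation o (suffix j).
Definition stops_at b := continuation (Some b) [::].

(** Only opening brackets emit, so that each terminal is read once. *)
Definition suffix_letter (b : bracket K) : seq T :=
  if b.2 then if suffix b.1 is inr a :: _ then [:: a] else [::] else [::].

Lemma suffix_cons j : exists X s, suffix j = X :: s.
Proof.
have : suffix j \in suffixes by exact: mem_nth.
rewrite inE => /orP[/eqP ->|/flattenP[_ /mapP[p _ ->] /mapP[i]]].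
  by exists (inl (start G)), [::].
rewrite mem_iota add0n => /= ltip ->.
case: p ltip => A [|X r] //= ltip.
by exists (nth X (X :: r) i), (drop i.+1 (X :: r)); rewrite -drop_nth.
Qed.

Definition suffix_closed (r : seq (symbol G)) :=
  forall r1 X r2, r = r1 ++ X :: r2 -> exists j, suffix j = X :: r2.

Lemma suffix_ofP r : r \in suffixes -> exists j, suffix j = r.
Proof. by case/(nthP [::]) => i ltiK <-; exists (Ordinal ltiK). Qed.

Lemma prods_suffix_closed A r : (A, r) \in prods G -> suffix_closed r.
Proof.
move=> rP r1 X r2 er; apply: suffix_ofP; rewrite inE; apply/orP; right.
apply/flattenP; exists [seq drop i r | i <- iota 0 (size r)].
  by apply/mapP; exists (A, r).
apply/mapP; exists (size r1); last by rewrite er drop_size_cat.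
by rewrite mem_iota er size_cat /= addnS ltnS leq_addr.
Qed.

(** Decoding: the pair of [X :: s] becomes the root [X], its interior the forest below [X], and the
    part after it the forest with roots [s]. *)
Lemma nested_parses o x : nested continues_at stops_at o x ->
  exists r t, continuation o r /\ parses r (letters suffix_letter x) t.
Proof.
elim=> [b fb|{}o j u v oj _ [r [t [cr pr]]] _ [s [t' [cs ps]]]].
  by exists [::], [::]; split=> //; exact: parses_nil.
exists (suffix j).
have [X [s' ej]] := suffix_cons j; move: oj cr cs.
rewrite letters_cons letters_cat letters_cons /continues_at /= ej.
rewrite /suffix_letter /= ej; case: X {ej} => [A|a] oj rP /eqP es; rewrite {s}es in ps.
  by exists (A :: t ++ t'); split=> //; exact: parses_rule rP pr ps.
rewrite (eqP rP) in pr; have [-> _] := parses_inv pr.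
by exists t'; split=> //; exact: parses_term.
Qed.

(** Coding: the first root together with the roots after it selects a bracket pair, which exists
    because the roots form a suffix of a right-hand side or the axiom. *)
Lemma parses_nested r w t : parses r w t -> suffix_closed r ->
  forall o, continuation o r ->
  exists2 x, nested continues_at stops_at o x & letters suffix_letter x = w.
Proof.
have tail X s : suffix_closed (X :: s) -> suffix_closed s.
  by move=> cl r1 Y r2 es; apply: (cl (X :: r1)); rewrite es.
elim=> [_ [b|//] cb|a {}r {}w {}t _ IH cl o co
       |A r' {}r u v t1 t2 rP _ IHu _ IHv cl o co].
- by exists [::] => //; exact: nested_nil.
- have [j ej] := cl [::] (inr a) r erefl.
  have [|x nx <-] := IH (tail _ _ cl) (Some (closing j)); first by rewrite /= ej.
  exists (opening j :: [::] ++ closing j :: x).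
    apply: nested_cons => //; first by rewrite /continues_at ej.
    by apply: nested_nil; rewrite /stops_at /= ej.
  by rewrite !letters_cons /suffix_letter /= ej.
- have [j ej] := cl [::] (inl A) r erefl.
  have [|x nx <-] := IHu (prods_suffix_closed rP) (Some (opening j)).
    by rewrite /= ej.
  have [|y ny <-] := IHv (tail _ _ cl) (Some (closing j)); first by rewrite /= ej.
  exists (opening j :: x ++ closing j :: y).
    by apply: nested_cons => //; rewrite /continues_at ej.
  by rewrite letters_cons letters_cat letters_cons /suffix_letter /= ej.
Qed.

Lemma cfg_lang_letters :
  cfg_lang G = letters suffix_letter @` nested continues_at stops_at None.
Proof.
apply/seteqP; split=> w.
  have cl : suffix_closed [:: inl (start G)].
    by case=> [|? []] // X r2 [<- <-]; apply: suffix_ofP; rewrite mem_head.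
  case/cfg_langP => t p.
  by have [x nx <-] := parses_nested p cl (o := None) (eqxx _); exists x.
case=> x /nested_parses[r [t [/eqP -> p]]] <-.
by apply/cfg_langP; exists t.
Qed.

End Suffixes.

(** * Traces of a grammar in Dyck normal form *)

Section DyckNormalForm.
Variables (T : finType) (G : cfg T) (k : nat) (br : bracket k -> nonterm G).
Hypotheses (nfG : dyck_nf G) (nameG : bracket_naming br).

(** The position before the first letter stands for the axiom, which the trace omits. *)
Definition bracket_nonterm o := if o is Some b then br b else start G.

Definition expands o (j : 'I_k) :=
  (bracket_nonterm o, [:: inl (br (opening j)); inl (br (closing j))])
    \in prods G.

Definition is_leaf b := [exists a, (br b, [:: inr a]) \in prods G].

Definition leaf_letter b : seq T :=
  if [pick a | (br b, [:: inr a]) \in prods G] is Some a then [:: a] else [::].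

Lemma binary_rule A B C : (A, [:: inl B; inl C]) \in prods G ->
  exists j, B = br (opening j) /\ C = br (closing j).
Proof. by move=> rP; case: nameG => _ _ _ /(_ B C)[] h _; apply: h; exists A. Qed.

(** A bracket is never the axiom, so the normal form allows it no rule besides a terminal one. This
    makes the choice in [leaf_letter] unique. *)
Lemma terminal_rule b a r : (br b, [:: inr a]) \in prods G ->
  (br b, r) \in prods G -> r = [:: inr a].
Proof. by case: nfG => _ t _ _; case: nameG => _ nS _ _ /t; apply. Qed.

Lemma leaf_letter_terminal b a : (br b, [:: inr a]) \in prods G ->
  leaf_letter b = [:: a].
Proof.
move=> ba; rewrite /leaf_letter; case: pickP => [c|/(_ a)]; last by rewrite ba.
by move/(terminal_rule ba) => [->].
Qed.

Lemma leaf_letter_expands b j : expands (Some b) j -> leaf_letter b = [::].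
Proof.
move=> ej; rewrite /leaf_letter; case: pickP => // a /terminal_rule.
by move=> /(_ _ ej).
Qed.

(** By induction on the preorder word: a bracket rewritten by a binary rule emits nothing, one
    rewritten by a terminal rule emits exactly that terminal. *)
Lemma parses_bracket b w t : parses [:: inl (br b)] w t -> exists x,
  [/\ nested expands is_leaf (Some b) x, t = br b :: map br x
    & w = letters leaf_letter (b :: x)].
Proof.
have [n] := ubnP (size t); elim: n b w t => // n IH b w t ltn.
case/parses1_inv => r [t' [rP p et]]; subst t.
have [[/(_ _ _ rP)[[B [C er]]|[a er]|[bS _]] _] _ _ _] := nfG.
- rewrite {r}er in rP p; have [j [eB eC]] := binary_rule rP; subst B C.
  move: p; rewrite -cat1s => /parses_split.
  case=> w1 [w2] [t1] [t2] [p1 p2 -> et]; move: ltn.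
  rewrite et /= ltnS size_cat => ltn.
  have [x [nx e1 ->]] := IH _ _ _ (leq_ltn_trans (leq_addr _ _) ltn) p1.
  have [y [ny e2 ->]] := IH _ _ _ (leq_ltn_trans (leq_addl _ _) ltn) p2.
  exists (opening j :: x ++ closing j :: y); split; first exact: nested_cons.
    by rewrite e1 e2 /= map_cat.
  by rewrite [RHS]letters_cons (leaf_letter_expands rP) -letters_cat.
- rewrite {r}er in rP p.
  have [w' [-> /parses_inv[-> ->]]] := parses_inv p.
  exists [::]; split=> //; first by apply: nested_nil; apply/existsP; exists a.
  by rewrite letters_cons (leaf_letter_terminal rP).
(* Only the axiom may have the empty rule, and it is no bracket. *)
- by case: nameG => _ /(_ b).
Qed.

(** The letter emitted by [o] is added in front because [o] stands outside [x]. *)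
Lemma nested_bracket o x : nested expands is_leaf o x ->
  parses [:: inl (bracket_nonterm o)]
    ((if o is Some b then leaf_letter b else [::]) ++ letters leaf_letter x)
    (bracket_nonterm o :: map br x).
Proof.
elim=> [b /existsP[a ba]|{}o j u v oj _ pu _ pv].
  rewrite (leaf_letter_terminal ba); apply: parses1 ba _.
  exact: (parses_terms _ [:: a]).
have -> : (if o is Some b then leaf_letter b else [::]) = [::].
  by case: o oj => // b; exact: leaf_letter_expands.
apply: parses1 oj _.
rewrite -cat_cons map_cat letters_cat; exact: parses_cat pu pv.
Qed.

(** Every bracket yields at least one terminal, so a binary rule at the axiom yields two, the length
    required of words with a trace. *)
Lemma nested_size o x : nested expands is_leaf o x ->
  if o is Some b then 1 <= size (leaf_letter b ++ letters leaf_letter x)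
  else 2 <= size (letters leaf_letter x).
Proof.
elim=> [b /existsP[a /leaf_letter_terminal ->] //|{}o j u v _ _ su _ sv].
have s2 : 2 <= size (letters leaf_letter (opening j :: u ++ closing j :: v)).
  rewrite letters_cons letters_cat letters_cons catA size_cat.
  exact: leq_add su sv.
by case: o => // b; rewrite size_cat (leq_trans (ltnW s2)) ?leq_addl.
Qed.

Lemma parses_start w t : parses [:: inl (start G)] w t ->
  (exists2 o, start_rule G o & w = oapp (cons^~ [::]) [::] o) \/
  (exists x, [/\ nested expands is_leaf None x, t = start G :: map br x
     & w = letters leaf_letter x]).
Proof.
case/parses1_inv => r [t' [rP p ->]].
have [[/(_ _ _ rP)[[B [C er]]|[a er]|[_ er]] _] _ _ _] := nfG;
  rewrite {r}er in rP p.
- right; have [j [eB eC]] := binary_rule rP; subst B C.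
  move: p; rewrite -cat1s => /parses_split.
  case=> w1 [w2] [t1] [t2] [/parses_bracket[x [nx -> ->]]].
  case/parses_bracket=> y [ny -> ->] -> ->.
  exists (opening j :: x ++ closing j :: y); split; first exact: nested_cons.
    by rewrite /= map_cat.
  by rewrite -cat_cons letters_cat.
- left; exists (Some a) => //.
  by have [w' [-> /parses_inv[-> _]]] := parses_inv p.
- by left; exists None => //; have [] := parses_inv p.
Qed.

Lemma start_rule_lang o : start_rule G o ->
  cfg_lang G (oapp (cons^~ [::]) [::] o).
Proof.
move=> So; apply/cfg_langP; eexists; apply: parses1 So _.
case: o => [a|]; [exact: (parses_terms _ [:: a]) | exact: parses_nil].
Qed.

Lemma nested_trace x : nested expands is_leaf None x <-> bracket_trace_lang br x.
Proof.
rewrite /bracket_trace_lang /mkset trace_langP.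
(* A rule from the axiom to a terminal or the empty word gives length at most one, against [w2]. *)
split=> [nx|[w w2 /parses_start[[[a|] _ ew]|[y [ny [exy] _]]]]].
- exists (letters leaf_letter x); first exact: nested_size nx.
  exact: nested_bracket nx.
- by rewrite ew in w2.
- by rewrite ew in w2.
- by case: nameG => /inj_map brI _ _ _; rewrite (brI _ _ exy).
Qed.

Lemma dnf_lang w : cfg_lang G w <->
  (exists2 o, start_rule G o & w = oapp (cons^~ [::]) [::] o) \/
  (exists2 x, nested expands is_leaf None x & letters leaf_letter x = w).
Proof.
split=> [/cfg_langP[t /parses_start[?|[x [nx _ ->]]]]|]; first by left.
  by right; exists x.
case=> [[o So ->]|[x nx <-]]; first exact: start_rule_lang.
by apply/cfg_langP; exists (start G :: map br x); exact: nested_bracket nx.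
Qed.

(** * New bracket pairs for the short words *)

Section Extended.
Variables (p : nat) (ts : p.-tuple (option T)).

Definition embed (b : bracket k) : bracket (k + p) := (lshift p b.1, b.2).

Definition unembed (b : bracket (k + p)) : option (bracket k) :=
  if split b.1 is inl i then Some (i, b.2) else None.

(** A new pair opens only at the beginning, and no opening bracket may follow a new bracket. *)
Definition ext_expands (o : option (bracket (k + p))) (j : 'I_(k + p)) : bool :=
  match split j, o with
  | inl i, None => expands None i
  | inl i, Some b => oapp (fun b' => expands (Some b') i) false (unembed b)
  | inr _, _ => o == None
  end.

(** The default [true] lets a new pair enclose the empty word and end the whole word. *)
Definition ext_is_leaf b := oapp is_leaf true (unembed b).

(** A new pair emits at its opening bracket only, and nothing when it stands for the empty word. *)
Definition ext_leaf_letter (b : bracket (k + p)) : seq T :=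
  match split b.1 with
  | inl i => leaf_letter (i, b.2)
  | inr j => if b.2 then oapp (cons^~ [::]) [::] (tnth ts j) else [::]
  end.

Lemma embedK b : unembed (embed b) = Some b.
Proof.
by case: b => i c; rewrite /unembed /embed /= -[lshift _ _]/(unsplit (inl _)) unsplitK.
Qed.

Lemma unembed_new j c : unembed (rshift k j, c) = None.
Proof. by rewrite /unembed /= -[rshift _ _]/(unsplit (inr _)) unsplitK. Qed.

Lemma letters_embed x :
  letters ext_leaf_letter (map embed x) = letters leaf_letter x.
Proof.
elim: x => //= -[i c] x IH; rewrite !letters_cons IH /ext_leaf_letter /=.
by rewrite -[lshift _ _]/(unsplit (inl _)) unsplitK.
Qed.

Lemma nested_embed o x : nested expands is_leaf o x ->
  nested ext_expands ext_is_leaf (omap embed o) (map embed x).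
Proof.
elim=> [b lb|{}o j u v oj _ nu _ nv] /=.
  by apply: nested_nil; rewrite /ext_is_leaf embedK.
rewrite map_cat; apply: nested_cons => //.
rewrite /ext_expands -[lshift _ _]/(unsplit (inl _)) unsplitK.
by case: o oj => //= b; rewrite embedK.
Qed.

Lemma nested_unembed o x : nested ext_expands ext_is_leaf o x ->
  match o with
  | Some b => if unembed b is Some b'
      then exists2 y, nested expands is_leaf (Some b') y & x = map embed y
      else x = [::]
  | None => (exists2 y, nested expands is_leaf None y & x = map embed y) \/
      exists j : 'I_p, x = [:: opening (rshift k j); closing (rshift k j)]
  end.
Proof.
elim=> [b|{}o j u v]; rewrite /ext_is_leaf.
  by case: unembed => //= b' lb; exists [::] => //; exact: nested_nil.
rewrite /ext_expands -[j]splitK; case: (split j) => i; rewrite unsplitK /=.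
  rewrite -[opening _]/(embed (opening i)) -[closing _]/(embed (closing i)).
  rewrite !embedK => oi _ [y ny ->] _ [z nz ->].
  have -> : embed (opening i) :: map embed y ++ embed (closing i) :: map embed z =
      map embed (opening i :: y ++ closing i :: z) by rewrite /= map_cat.
  case: o oi => [b|] oi; last by left; eexists; first exact: nested_cons oi ny nz.
  case: (unembed b) oi => //= b' oi.
  by eexists; first exact: nested_cons oi ny nz.
(* For a new pair both the interior and the part after it are empty. *)
by rewrite !unembed_new => /eqP -> _ -> _ ->; right; exists i.
Qed.

Lemma nested_ext :
  nested ext_expands ext_is_leaf None = extended_trace_lang br (p := p).
Proof.
apply/seteqP; split=> x.
  case/nested_unembed => [[y /nested_trace ty ->]|]; last by right.
  by left; exists y.
case=> [[y /nested_trace ty <-]|[j ->]]; first exact: nested_embed ty.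
apply: (@nested_cons _ _ _ None (rshift k j) [::] [::]).
- by rewrite /ext_expands -[rshift _ _]/(unsplit (inr _)) unsplitK.
- by apply: nested_nil; rewrite /ext_is_leaf unembed_new.
- by apply: nested_nil; rewrite /ext_is_leaf unembed_new.
Qed.

Lemma ext_lang : enumerates_start_rules G ts ->
  cfg_lang G = letters ext_leaf_letter @` extended_trace_lang br (p := p).
Proof.
case=> _ tsP.
have new j : letters ext_leaf_letter
    [:: opening (rshift k j); closing (rshift k j)] =
    oapp (cons^~ [::]) [::] (tnth ts j).
  rewrite !letters_cons /ext_leaf_letter /=.
  by rewrite -[rshift _ _]/(unsplit (inr _)) unsplitK cats0.
apply/seteqP; split=> w.
  case/dnf_lang => [[o So ->]|[x nx <-]].
    move: So; rewrite -tsP => /tnthP[j ->]; rewrite -new.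
    by eexists; first by right; exists j.
  rewrite -letters_embed; exists (map embed x) => //.
  by left; exists x; first exact/nested_trace.
case=> x [[y /nested_trace ny <-] <-|[j ->] <-]; apply/dnf_lang.
  by right; exists y => //; rewrite -letters_embed.
by left; rewrite new; exists (tnth ts j) => //; rewrite -tsP mem_tnth.
Qed.

End Extended.
End DyckNormalForm.

(** * Choice of [K], [R] and [h] in each case *)

Theorem theorem3p5 (T : finType) (L : set (seq T)) (cfL : context_free L) :
  (exists (K : nat) (R : set (seq (bracket K))) (h : seq (bracket K) -> seq T),
     [/\ regular R, word_hom h & L = h @` (@dyck K `&` R)]) /\
  (forall (G Gk : cfg T) (k : nat) (br : bracket k -> nonterm Gk),
     cfg_lang G = L -> dyck_nf Gk -> cfg_lang Gk = cfg_lang G ->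
     bracket_naming br ->
     (~ has_extended Gk ->
        exists (R : set (seq (bracket k))) (h : seq (bracket k) -> seq T),
          [/\ regular R, word_hom h, L = h @` (@dyck k `&` R) &
              @dyck k `&` R = bracket_trace_lang br]) /\
     (has_extended Gk ->
        exists (p : nat) (ts : p.-tuple (option T)),
          [/\ 0 < p, enumerates_start_rules Gk ts &
           exists (R : set (seq (bracket (k + p))))
                  (h : seq (bracket (k + p)) -> seq T),
             [/\ regular R, word_hom h, L = h @` (@dyck (k + p) `&` R) &
                 @dyck (k + p) `&` R = extended_trace_lang br (p := p)]])).
Proof.
split.
  have [G ->] := cfL.
  exists (size (suffixes G)),
    (dfa_lang (chain_dfa (@continues_at _ G) (@stops_at _ G))),
    (letters (@suffix_letter _ G)); rewrite dyck_chained.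
  by split; [eexists | exact: letters_hom | exact: cfg_lang_letters].
move=> G Gk k br <- nf <- naming; split=> [noS|[o So]].
  have traces : nested (expands br) (is_leaf br) None = bracket_trace_lang br.
    by apply/seteqP; split=> x /(nested_trace nf naming).
  exists (dfa_lang (chain_dfa (expands br) (is_leaf br))), (letters (leaf_letter br)).
  rewrite dyck_chained; split=> //; [by eexists | exact: letters_hom |].
  apply/seteqP; split=> w; last by move=> ?; apply/(dnf_lang nf naming); right.
  by case/(dnf_lang nf naming) => // -[o So]; case: noS; exists o.
(* Filtering the finite type [option T] lists each start rule once; its length is [p], positive
   because [o] is in the list. *)
pose ts := in_tuple (filter (@start_rule T Gk) (enum {: option T})).
have tsP : enumerates_start_rules Gk ts.
  split=> [|t]; first by rewrite filter_uniq ?enum_uniq.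
  by rewrite [t \in ts]mem_filter mem_enum andbT.
exists _, ts; split=> //.
  rewrite -has_predT; apply/hasP; exists o => //.
  by rewrite -[_ \in _]/(o \in ts) tsP.2.
exists (dfa_lang (chain_dfa (@ext_expands _ _ _ br _) (@ext_is_leaf _ _ _ br _))).
exists (letters (ext_leaf_letter br ts)); rewrite dyck_chained nested_ext //.
by split=> //; [eexists | exact: letters_hom | exact: ext_lang].
Qed.
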